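(* Let $X$ be a nonempty set, let $L$ be a subset of the closed unit ball of $\ell_\infty(X)$, and let $(\mu_j)_{j\ge 1}$ be a sequence in $\mathcal{F}(X)$. Assume that $(\mu_j)$ converges pointwise on $L$, that is, there exists a function $\mu : L \to \mathbb{R}$ such that $\mu_j(f) \to \mu(f)$ as $j \to \infty$ for every $f \in L$. Then there is a sequence $(x_n)_{n \ge 1}$ with $x_n \in \bigcup_{j=1}^\infty \operatorname{supp} \mu_j$ for all $n$ such that, with $\upsilon_N = \frac{\delta_{x_1} + \dots + \delta_{x_N}}{N}$: (1) $\upsilon_N(f) \to \mu(f)$ as $N \to \infty$ for every $f \in L$ (that is, $\upsilon_N \to \mu$ pointwise on $L$); (2) moreover, if $(\mu_j)$ converges to $\mu$ uniformly on $L$, then $(\upsilon_N)$ converges to $\mu$ uniformly on $L$.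
   Context: $\ell_\infty(X)$ is the Banach space of all bounded real-valued functions on $X$ with the sup-norm. For $x \in X$, $\delta_x$ is the Dirac measure at $x$, acting by $\delta_x(f) = f(x)$ for $f\in \ell_\infty(X)$. $\mathcal{F}(X)$ is the set of probability measures of finite support on $X$, i.e. $\mathcal{F}(X)=\operatorname{co}(\{\delta_x : x \in X\})$. If $\nu = \sum_{k=1}^n \lambda_k \delta_{x_k}$ with $x_1,\dots,x_n$ distinct, $\lambda_k > 0$ and $\sum_{k=1}^n \lambda_k = 1$, then $\operatorname{supp} \nu = \{x_1,\dots,x_n\}$ and $\nu(f) = \int_X f\, d\nu = \sum_{k=1}^n \lambda_k f(x_k)$. *)

(* Defs.v *)
From HB Require Import structures.
From mathcomp Require Import all_boot all_order all_algebra.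
From mathcomp Require Import all_classical all_reals all_analysis.

Set Implicit Arguments.
Unset Strict Implicit.
Unset Printing Implicit Defensive.

Import Order.TTheory GRing.Theory Num.Theory.
Import numFieldNormedType.Exports.

Local Open Scope classical_set_scope.
Local Open Scope ring_scope.

Section Definitions.
Context {R : realType} {X : Type}.
Implicit Types (f : X -> R) (nu : (X -> R) -> R).

Definition linf : set (X -> R) := [set f | bounded_fun f].

Definition linf_norm f : R := sup (range (fun x => `|f x|)).

Definition linf_unit_ball : set (X -> R) :=
  [set f | linf f /\ linf_norm f <= 1].

(* A finitely supported measure is identified with the functional
   f |-> \int f d nu it induces; the vector operations below are the pointwise
   ones on functionals. *)
Definition delta (x : X) : (X -> R) -> R := fun f => f x.

Definition finite_prob : set ((X -> R) -> R) :=
  [set nu | exists (n : nat) (lam : 'I_n -> R) (x : 'I_n -> X),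
    [/\ forall k, 0 <= lam k,
        \sum_(k < n) lam k = 1
      & nu = \sum_(k < n) lam k *: delta (x k)]].

(* y is an atom of a representation of nu with distinct atoms and positive
   weights; such a representation is unique up to reordering. *)
Definition fsupp nu : set X :=
  [set y | exists (n : nat) (lam : 'I_n -> R) (x : 'I_n -> X),
    [/\ injective x,
        forall k, 0 < lam k,
        \sum_(k < n) lam k = 1,
        nu = \sum_(k < n) lam k *: delta (x k)
      & range x y]].

(* Sequences are indexed from 0: x 0, ..., x N.-1 are the first N terms. *)
Definition averages (x : nat -> X) (N : nat) : (X -> R) -> R :=
  N%:R^-1 *: \sum_(n < N) delta (x n).

End Definitions.

(* Main.v *)
Require Import Defs.
From mathcomp Require Import all_boot all_order all_algebra.
From mathcomp Require Import all_classical all_reals all_analysis.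
From mathcomp Require Import zify ring lra.

Import Order.TTheory GRing.Theory Num.Theory.
Import numFieldNormedType.Exports.

Local Open Scope classical_set_scope.
Local Open Scope ring_scope.

(** The points x_n are chosen greedily. Fix a schedule j : nat -> nat that
tends to infinity, and regard mu_(j n) as the target at time n. For a point y,
let the deficit D_N(y) be the mass that the targets of times n < N put on y,
minus the number of n < N with x_n = y. At time N, let x_N be any point with
D_N + mu_(j N) > 0; there is one, since the deficits sum to 0 and mu_(j N) has
total mass 1. Two facts follow.

- x_N has received mass from one of the first targets, so it belongs to one of
  the supports ([greedy_charged]).
- Subtracting 1 from a positive number leaves every deficit at least -1. Since
  the deficits sum to 0 and vanish outside the set T_N of points charged so
  far, their absolute values sum to at most 2 |T_N|. Hence
  |sum_(n < N) (mu_(j n) f - f x_n)| <= 2 |T_N| for every f bounded by 1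
  ([greedy_discrepancy]).

When j grows slowly enough, |T_N| / N tends to 0 ([slow_schedule]), so the
averages of the x_n and the Cesaro means of mu_(j n) differ by o(1), uniformly
over the unit ball ([exists_slow_greedy]). As mu_(j n) converges to mu
uniformly on any set A where mu_ does, so do its Cesaro means, and with them
the averages of the x_n ([averages_uniform_cvg]). Taking for A the whole of L
gives the uniform statement; taking singletons {f} gives the pointwise one,
with the same sequence x. *)

(** * Point masses of finitely supported probabilities *)

Section FinitelySupported.
Context {R : realType} {X : choiceType}.
Implicit Types (nu : (X -> R) -> R) (f : X -> R) (s T : seq X) (y : X).

(** Reading the weight of a point off the functional itself frees the weights
from the choice of a representation, in which points may be repeated. *)
Definition mass nu y : R := nu (fun z => (z == y)%:R).

Definition prob_on T (q : X -> R) :=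
  [/\ forall y, 0 <= q y, forall y, y \notin T -> q y = 0
    & \sum_(y <- T) q y = 1].

Lemma functional_sumE (I : Type) (r : seq I) (lam : I -> R) (x : I -> X) f :
  (\sum_(k <- r) lam k *: delta (x k)) f = \sum_(k <- r) lam k * f (x k).
Proof. by rewrite fct_sumE. Qed.

Lemma sum_mem_uniq (s T : seq X) (g : X -> R) : uniq s -> uniq T ->
  {subset s <= T} -> \sum_(y <- T | y \in s) g y = \sum_(y <- s) g y.
Proof.
move=> us uT sT; rewrite -big_filter; apply: perm_big.
apply: uniq_perm => // [|y]; first exact: filter_uniq.
by rewrite mem_filter; case: (boolP (y \in s)) => // /sT ->.
Qed.

Lemma finite_prob_mass_ge0 nu y : finite_prob nu -> 0 <= mass nu y.
Proof.
move=> [n [lam [x [lam0 _ ->]]]]; rewrite /mass functional_sumE.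
by apply: sumr_ge0 => k _; rewrite mulr_ge0.
Qed.

(** Merging the repeated points of a representation, and dropping those of
weight 0, yields the reduced form on which [fsupp] is based. *)
Lemma finite_prob_atoms nu : finite_prob nu ->
  exists s, [/\ uniq s, forall y, (y \in s) = (0 < mass nu y)
    & forall f, nu f = \sum_(y <- s) mass nu y * f y].
Proof.
move=> Pnu; have mass0 := finite_prob_mass_ge0 nu ^~ Pnu.
have [n [lam [x [lam0 lam1 nuE]]]] := Pnu.
have massE y : mass nu y = \sum_(k < n | x k == y) lam k.
  rewrite /mass nuE functional_sumE [RHS]big_mkcond; apply: eq_bigr => k _.
  by case: eqP; rewrite ?mulr1 ?mulr0.
pose T := undup [seq x k | k <- enum 'I_n].
have xT k : x k \in T by rewrite mem_undup map_f // mem_enum.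
exists [seq y <- T | 0 < mass nu y]; split.
- by rewrite filter_uniq // undup_uniq.
- move=> y; rewrite mem_filter; case: ltrP => //= /lt0r_neq0.
  rewrite massE => /eqP; apply: contra_notT => yT.
  rewrite big_pred0 // => k; apply/eqP => xky.
  by rewrite -xky xT in yT.
move=> f; rewrite big_filter big_rmcond_in; last first.
  move=> y _; rewrite -leNgt => my0.
  by rewrite (@le_anti _ _ (mass nu y) 0) ?mul0r // my0 mass0.
rewrite [LHS](_ : _ = \sum_k lam k * f (x k)); last by rewrite nuE functional_sumE.
under [RHS]eq_bigr do rewrite massE mulr_suml big_mkcond.
rewrite exchange_big /=; apply: eq_bigr => k _.
rewrite -big_mkcond (big_rem (x k)) //= eqxx big_seq_cond big1 ?addr0 //.
move=> y; rewrite mem_rem_uniq ?undup_uniq // inE => /andP[/andP[/= yx _]].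
by rewrite eq_sym (negPf yx).
Qed.

Lemma finite_prob1 nu : finite_prob nu -> nu (fun=> 1) = 1.
Proof.
move=> [n [lam [x [_ lam1 ->]]]]; rewrite functional_sumE -[RHS]lam1.
by apply: eq_bigr => k _; rewrite mulr1.
Qed.

Lemma mem_fsupp nu y : finite_prob nu -> 0 < mass nu y -> fsupp nu y.
Proof.
move=> Pnu my; have [s [us sE nuE]] := finite_prob_atoms _ Pnu.
exists (size s), (fun k => mass nu (tnth (in_tuple s) k)), (tnth (in_tuple s)).
split.
- exact/tuple_uniqP.
- by move=> k; rewrite -sE mem_tnth.
- have := finite_prob1 _ Pnu; rewrite nuE (big_tnth _ _ s) => <-.
  by apply: eq_bigr => k _; rewrite mulr1.
- by apply/funext => f; rewrite nuE functional_sumE (big_tnth _ _ s).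
by have /seq_tnthP [k ->] : y \in s; [rewrite sE|exists k].
Qed.

Lemma finite_prob_sum_mass {nu T} f : finite_prob nu -> uniq T ->
  (forall y, 0 < mass nu y -> y \in T) ->
  \sum_(y <- T) mass nu y * f y = nu f.
Proof.
move=> Pnu uT muT; have [s [us sE ->]] := finite_prob_atoms _ Pnu.
rewrite -(@sum_mem_uniq s T) //; last first.
  by move=> y; rewrite sE; apply: muT.
rewrite [RHS]big_mkcond; apply: eq_bigr => y _; rewrite sE; case: ltP => // m0.
by rewrite (@le_anti _ _ (mass nu y) 0) ?mul0r // m0 finite_prob_mass_ge0.
Qed.

Lemma prob_on_mass {nu T} : finite_prob nu -> uniq T ->
  (forall y, 0 < mass nu y -> y \in T) -> prob_on T (mass nu).
Proof.
move=> Pnu uT muT; split => [y|y yT|]; first exact: finite_prob_mass_ge0.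
  apply/eqP; rewrite eq_le finite_prob_mass_ge0 // andbT leNgt.
  by apply: contra yT => /muT.
rewrite -(finite_prob1 _ Pnu) -(finite_prob_sum_mass _ Pnu uT muT).
by apply: eq_bigr => y _; rewrite mulr1.
Qed.

Lemma finite_prob_norm_le nu f : finite_prob nu ->
  (forall y, `|f y| <= 1) -> `|nu f| <= 1.
Proof.
move=> [n [lam [x [lam0 lam1 ->]]]] f1; rewrite functional_sumE.
apply: (le_trans (ler_norm_sum _ _ _)); rewrite -[leRHS]lam1.
apply: ler_sum => k _; rewrite normrM (ger0_norm (lam0 k)).
by rewrite ler_piMr.
Qed.

End FinitelySupported.

(** * The greedy sequence *)

Section Greedy.
Context {R : realType} {X : choiceType} (x0 : X) (p : nat -> X -> R).
Implicit Types (T : seq X) (N : nat) (f : X -> R).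

Definition pick_pos (g : X -> R) : X := xget x0 [set y | 0 < g y].

Fixpoint deficit N : X -> R :=
  if N is n.+1 then
    fun y => deficit n y + p n y - (y == pick_pos (deficit n \+ p n))%:R
  else fun=> 0.

Definition greedy N : X := pick_pos (deficit N \+ p N).

Lemma deficitE N y :
  deficit N y = \sum_(n < N) p n y - \sum_(n < N) (y == greedy n)%:R.
Proof.
elim: N => [|N IH]; first by rewrite !big_ord0 subrr.
by rewrite !big_ord_recr /= IH /greedy; ring.
Qed.

Lemma sum_deficit {T N} f : (forall n, (n < N)%N -> greedy n \in T) -> uniq T ->
  \sum_(y <- T) deficit N y * f y =
  \sum_(n < N) (\sum_(y <- T) p n y * f y - f (greedy n)).
Proof.
move=> gT uT; rewrite sumrB exchange_big /=.
have -> : \sum_(n < N) f (greedy n) =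
    \sum_(y <- T) \sum_(n < N) (y == greedy n)%:R * f y.
  rewrite exchange_big /=; apply: eq_bigr => n _.
  rewrite (bigD1_seq (greedy n)) ?gT //= eqxx mul1r big1 ?addr0 // => y.
  by move/negPf ->; rewrite mul0r.
by rewrite -sumrB; apply: eq_bigr => y _; rewrite deficitE mulrBl !mulr_suml.
Qed.

Lemma sum_deficit_eq0 {T N} : (forall n, (n < N)%N -> greedy n \in T) ->
  uniq T -> (forall n, (n < N)%N -> prob_on T (p n)) ->
  \sum_(y <- T) deficit N y = 0.
Proof.
move=> gT uT pT; transitivity (\sum_(y <- T) deficit N y * 1).
  by apply: eq_bigr => y _; rewrite mulr1.
rewrite (sum_deficit (fun=> 1)) //; apply: big1 => n _.
have [_ _ pT1] := pT n (ltn_ord n); rewrite -[X in _ - X]pT1 -sumrB.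
by apply: big1 => y _; rewrite mulr1 subrr.
Qed.

(** The three claims need one another. Positivity at the chosen point gives the
lower bound -1 after the unit has been subtracted, and it puts that point in T,
because deficit and weights vanish off T. Conversely a positive point exists
because all earlier choices lie in T, so that the deficits sum to 0 over T. *)
Lemma greedy_invariant {T N} : uniq T ->
  (forall n, (n < N)%N -> prob_on T (p n)) ->
  [/\ forall n, (n < N)%N -> greedy n \in T,
      forall n, (n < N)%N -> 0 < deficit n (greedy n) + p n (greedy n)
    & forall y, -1 <= deficit N y].
Proof.
move=> uT; elim: N => [|N IH] pT; first by split => // y /=; rewrite lerN10.
have [gT g0 d1] := IH (fun n nN => pT n (ltnW nN)).
have [pNge0 pN0 pN1] := pT N (leqnn _).
have dN0 y : y \notin T -> deficit N y = 0.
  move=> yT; rewrite deficitE !big1 ?subrr // => n _.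
    by case: eqP => // yg; rewrite yg gT in yT.
  by have [_ ->] := pT n (ltnW (ltn_ord n)).
have gN : 0 < deficit N (greedy N) + p N (greedy N).
  apply: (@xgetPex _ x0 [set y | 0 < deficit N y + p N y]).
  apply/not_existsP => le0.
  have : \sum_(y <- T) (deficit N y + p N y) = 1.
    rewrite big_split /= pN1 sum_deficit_eq0 ?add0r // => n nN.
    by apply: pT; apply: ltnW.
  apply/eqP; rewrite lt_eqF //; apply: (@le_lt_trans _ _ 0) => //.
  by apply: sumr_le0 => y _; rewrite leNgt; apply/negP/le0.
have gNT : greedy N \in T.
  apply: contraTT gN => gNT; rewrite dN0 // pN0 // addr0 ltxx //.
split.
- by move=> n; rewrite ltnS leq_eqVlt => /predU1P[->//|/gT].
- by move=> n; rewrite ltnS leq_eqVlt => /predU1P[->//|/g0].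
move=> y /=; rewrite -/(greedy N); case: eqP => [->|_].
  by rewrite -[leLHS]add0r lerD2r ltW.
by rewrite subr0 ler_wpDr.
Qed.

(** The left-hand side is the deficit integrated against f, hence at most the
l1-norm of the deficit; a function with sum 0 and values at least -1 on T has
l1-norm at most 2 |T|. *)
Lemma greedy_discrepancy {T N} f : uniq T ->
  (forall n, (n < N)%N -> prob_on T (p n)) -> (forall y, `|f y| <= 1) ->
  `|\sum_(n < N) (\sum_(y <- T) p n y * f y - f (greedy n))| <=
  2 * (size T)%:R.
Proof.
move=> uT pT f1; have [gT _ dge] := greedy_invariant uT pT.
rewrite -sum_deficit //; apply: (le_trans (ler_norm_sum _ _ _)).
(* |d| <= d + 2 whenever -1 <= d, and the deficits sum to 0 over T. *)
apply: (@le_trans _ _ (\sum_(y <- T) (deficit N y + 2))).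
  apply: ler_sum => y _; rewrite normrM.
  apply: (@le_trans _ _ `|deficit N y|); first by rewrite ler_piMr.
  by rewrite ler_norml; have := dge y => ?; apply/andP; split; lra.
by rewrite big_split /= sum_deficit_eq0 // add0r big_const_seq count_predT iter_addr_0 mulr_natr.
Qed.

(** The chosen point has positive deficit plus weight, and a deficit is at most
the mass received so far. *)
Lemma greedy_charged {T N} : uniq T ->
  (forall n, (n <= N)%N -> prob_on T (p n)) ->
  exists2 n, (n <= N)%N & 0 < p n (greedy N).
Proof.
move=> uT pT; have [_ /(_ N (leqnn _)) g0 _] := @greedy_invariant T N.+1 uT pT.
apply/not_exists2P => p0; move: g0; apply/negP; rewrite -leNgt deficitE addrAC.
have pN0 n : (n <= N)%N -> p n (greedy N) <= 0.
  by move=> nN; rewrite leNgt; apply/negP => pn; have [/(_ nN)|] := p0 n.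
rewrite subr_le0; apply: (@le_trans _ _ 0); last first.
  by apply: sumr_ge0 => n _; rewrite ler0n.
rewrite -(big_ord_recr N (fun n : 'I_N.+1 => p n (greedy N))) /=.
by apply: sumr_le0 => n _; apply: pN0; rewrite -ltnS.
Qed.
End Greedy.

(** * Slow schedules *)

(** Take for j N the largest i <= N such that i * C i <= N: this maximum is
monotone in N, and it is at least M once N exceeds both M and M * C M. The
bound makes C (j N) <= N / j N negligible with respect to N. *)
Lemma slow_schedule (C : nat -> nat) : exists j : nat -> nat,
  [/\ {homo j : m n / (m <= n)%N}, j N @[N --> \oo] --> \oo
    & forall N, (j N * C (j N) <= N)%N].
Proof.
exists (fun N => \max_(i < N.+1 | (i * C i <= N)%N) i); split.
- move=> m n mn; apply/bigmax_leqP => i iC.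
  have mn' : (m.+1 <= n.+1)%N by [].
  exact: (leq_bigmax_cond (widen_ord mn' i) (leq_trans iC mn)).
- apply/cvgnyPge => M; near=> N.
  have MN : (M < N.+1)%N by rewrite ltnS; near: N; exact: nbhs_infty_ge.
  apply: (leq_bigmax_cond (Ordinal MN)) => /=.
  by clear MN; near: N; exact: nbhs_infty_ge.
move=> N; apply: (big_ind (fun m => m * C m <= N)%N) => // m n Hm Hn.
by rewrite /maxn; case: ifP.
Unshelve. all: by end_near. Qed.

(** The sequence produced here depends on the measures only, and not on any set
of functions: this is what allows one sequence to serve for all the functions
of L and for both modes of convergence. *)
Lemma exists_slow_greedy {R : realType} {X : choiceType}
    (mu_ : nat -> (X -> R) -> R) : (forall i, finite_prob (mu_ i)) ->
  exists (x : nat -> X) (j : nat -> nat),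
    [/\ forall n, (\bigcup_i fsupp (mu_ i)) (x n),
        j N @[N --> \oo] --> \oo
      & forall e, 0 < e -> \forall N \near \oo,
          forall f, (forall y, `|f y| <= 1) ->
          `|\sum_(n < N) (mu_ (j n) f - f (x n))| <= e * N%:R].
Proof.
move=> Pmu.
have [s sP] := choice (fun i => finite_prob_atoms _ (Pmu i)).
have [x0 _] : exists x0 : X, True.
  have [_ _ nuE] := sP 0%N; have := finite_prob1 _ (Pmu 0%N).
  rewrite nuE; case: (s 0%N) => [|x0 ? _]; last by exists x0.
  by rewrite big_nil => /eqP; rewrite eq_sym oner_eq0.
(* The points charged by the first i + 1 measures; j being monotone, those of
   index j N contain the atoms of all targets up to time N. *)
pose atoms i := undup (flatten [seq s l | l <- iota 0 i.+1]).
have uatoms i : uniq (atoms i) by exact: undup_uniq.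
have atomsP i k y : (i <= k)%N -> 0 < mass (mu_ i) y -> y \in atoms k.
  move=> ik my; rewrite mem_undup; apply/flatten_mapP; exists i.
    by rewrite mem_iota.
  by have [_ -> _] := sP i.
have [j [jmono joo jC]] := slow_schedule (fun i => size (atoms i)).
pose p n := mass (mu_ (j n)).
have onp n N : (n <= N)%N -> prob_on (atoms (j N)) (p n).
  by move=> nN; apply: prob_on_mass => // y; apply/atomsP/jmono.
exists (greedy x0 p), j; split => //.
  move=> n; have [m _ pm] := greedy_charged x0 p (uatoms _) (fun m => onp m n).
  by exists (j m) => //; apply: mem_fsupp.
move=> e e0.
have [M eM] : exists M : nat, 2 <= e * M%:R.
  exists (Num.bound (2 / e)); rewrite mulrC -ler_pdivrMr //.
  by rewrite ltW // archi_boundP // divr_ge0 // ltW.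
near=> N => f f1.
have jN : (M <= j N)%N by near: N; exact: (@cvgnyPge _ _ _ j).1.
have -> : \sum_(n < N) (mu_ (j n) f - f (greedy x0 p n)) =
    \sum_(n < N) (\sum_(y <- atoms (j N)) p n y * f y - f (greedy x0 p n)).
  apply: eq_bigr => n _; rewrite finite_prob_sum_mass // => y.
  by apply/atomsP/jmono/ltnW.
apply: (le_trans (greedy_discrepancy x0 p f (uatoms _) _ f1)).
  by move=> n /ltnW; apply: onp.
apply: (@le_trans _ _ (e * (j N * size (atoms (j N)))%:R)); last first.
  by rewrite ler_pM2l // ler_nat.
rewrite natrM mulrA ler_wpM2r // (le_trans eM) // ler_pM2l //.
by rewrite ler_nat.
Unshelve. all: by end_near. Qed.

(** * Uniform Cesaro convergence *)

Lemma uniform_cvgrP {R : realType} {U : choiceType} {I : Type}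
    {F : set_system I} {FF : Filter F} (A : set U) (g_ : I -> U -> R)
    (g : U -> R) :
  {uniform A, g_ @ F --> g} <->
  (forall e, 0 < e -> \forall i \near F, forall u, A u -> `|g u - g_ i u| <= e).
Proof.
split=> [gA e e0|gA P /uniform_nbhs[E [entE sEP]]].
  apply: (gA [set h | forall u, A u -> `|g u - h u| <= e]).
  apply/uniform_nbhs; exists [set xy | ball xy.1 e xy.2]; split.
    by have := entourage_ball R (PosNum e0).
  by move=> h /= hE u /hE; rewrite /ball /= => /ltW.
move: entE; rewrite -entourage_from_ballE => -[e /= e0 eE].
have e20 : 0 < e / 2 by rewrite divr_gt0.
apply: filterS (gA _ e20) => i giA; apply: sEP => u /giA gu.
apply: eE; rewrite /ball /=; apply: le_lt_trans gu _.
by rewrite ltr_pdivrMr // ltr_pMr // ltr1n.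
Qed.

(** Cesaro's argument, uniformly in f: apart from the first N1 terms, which
weigh O(1 / N) because mu is bounded on A, each mu_(j n) f is close to mu f;
replacing mu_(j n) f by f (x n) costs o(1) by assumption. *)
Lemma averages_uniform_cvg {R : realType} {X : Type} {A : set (X -> R)}
    {mu_ : nat -> (X -> R) -> R} {mu : (X -> R) -> R}
    {x : nat -> X} {j : nat -> nat} :
  (forall i f, A f -> `|mu_ i f| <= 1) ->
  j N @[N --> \oo] --> \oo ->
  (forall e, 0 < e -> \forall N \near \oo, forall f, A f ->
     `|\sum_(n < N) (mu_ (j n) f - f (x n))| <= e * N%:R) ->
  {uniform A, mu_ @ \oo --> mu} -> {uniform A, averages x @ \oo --> mu}.
Proof.
move=> mu1 joo osum /uniform_cvgrP muA; apply/uniform_cvgrP => e e0.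
pose d := e / 3; have d0 : 0 < d by rewrite divr_gt0.
have [N1 _ muN1] : \forall n \near \oo, forall f, A f ->
    `|mu f - mu_ (j n) f| <= d by exact: joo (muA _ d0).
(* |mu f| <= d + 1, by comparison with mu_(j N1) f, which bounds the early
   terms by d + 2. *)
have mu_far n f : A f -> `|mu f - mu_ (j n) f| <= d + 2 * (n < N1)%:R.
  move=> Af; case: ltnP => nN1; last by rewrite mulr0 addr0 muN1.
  apply: (le_trans (ler_distD (mu_ (j N1) f) _ _)).
  rewrite mulr1 lerD ?muN1 //=.
  by rewrite (le_trans (ler_normB _ _)) // -[leRHS]/(1 + 1) lerD ?mu1.
have countE N : (\sum_(n < N) (n < N1)%:R : R) <= N1%:R.
  rewrite -natr_sum ler_nat; suff -> : (\sum_(n < N) (n < N1) = minn N N1)%N.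
    exact: geq_minr.
  elim: N => [|N IH]; first by rewrite big_ord0 min0n.
  rewrite big_ord_recr /= IH; case: ltnP; lia.
near=> N => f Af.
have N0 : 0 < N%:R :> R by rewrite ltr0n; near: N; exact: nbhs_infty_gt.
have N1N : 2 * N1%:R <= d * N%:R.
  rewrite mulrC -ler_pdivrMl // mulrC; near: N; exact: nbhs_infty_ger.
have -> : averages x N f = N%:R^-1 * \sum_(n < N) f (x n).
  by rewrite /averages /= fct_sumE.
have -> : mu f - N%:R^-1 * \sum_(n < N) f (x n) =
  N%:R^-1 * (\sum_(n < N) (mu f - mu_ (j n) f)
     + \sum_(n < N) (mu_ (j n) f - f (x n))).
  rewrite -big_split /=; under [in RHS]eq_bigr do rewrite addrA subrK.
  rewrite sumrB sumr_const card_ord mulrBr -[mu f *+ N]mulr_natl.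
  rewrite mulrA mulVf ?mul1r //.
  exact: lt0r_neq0.
rewrite normrM gtr0_norm ?invr_gt0 // ler_pdivrMl //.
have far : `|\sum_(n < N) (mu f - mu_ (j n) f)| <= d * N%:R + 2 * N1%:R.
  apply: (le_trans (ler_norm_sum _ _ _)).
  apply: (@le_trans _ _ (\sum_(n < N) (d + 2 * (n < N1)%:R))).
    by apply: ler_sum => n _; exact: mu_far.
  rewrite big_split /= sumr_const card_ord mulr_natr lerD2l -mulr_sumr.
  by rewrite ler_pM2l //; exact: countE.
have near_ : `|\sum_(n < N) (mu_ (j n) f - f (x n))| <= d * N%:R.
  by clear far; move: f Af; near: N; exact: osum.
apply: (le_trans (ler_normD _ _)).
have -> : N%:R * e = d * N%:R + d * N%:R + d * N%:R by rewrite /d; field.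
by apply: lerD => //; apply: le_trans far _; rewrite lerD2l.
Unshelve. all: by end_near. Qed.

Lemma linf_unit_ball_le1 {R : realType} {X : Type} (f : X -> R) :
  linf_unit_ball f -> forall y, `|f y| <= 1.
Proof.
move=> [[M [_ fM]] f1] y; apply: le_trans f1.
have fub : has_ubound (range (fun x => `|f x|)).
  by exists (M + 1) => _ [z _ <-]; apply: (fM (M + 1)); rewrite ?ltrDl.
by apply: (ub_le_sup fub); exists y.
Qed.

(** * Pointwise and uniform convergence on L *)

Theorem theorem1 (R : realType) (X : Type) (L : set (X -> R))
    (mu_ : nat -> (X -> R) -> R) (mu : (X -> R) -> R) :
  [set: X] !=set0 ->
  L `<=` linf_unit_ball ->
  (forall j, finite_prob (mu_ j)) ->
  (forall f, L f -> mu_ j f @[j --> \oo] --> mu f) ->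
  exists x : nat -> X,
    [/\ forall n, (\bigcup_j fsupp (mu_ j)) (x n),
        forall f, L f -> averages x N f @[N --> \oo] --> mu f
      & {uniform L, mu_ @ \oo --> mu} ->
        {uniform L, (averages x) @ \oo --> mu}].
Proof.
move=> _ L1 Pmu muL.
have [x [j [xsupp joo osum]]] := @exists_slow_greedy R {classic X} mu_ Pmu.
have avg A : A `<=` L ->
    {uniform A, mu_ @ \oo --> mu} -> {uniform A, averages x @ \oo --> mu}.
  move=> AL; have A1 f : A f -> forall y, `|f y| <= 1.
    by move=> /AL/L1; exact: linf_unit_ball_le1.
  apply: (averages_uniform_cvg _ joo).
    by move=> i f /A1; exact: (@finite_prob_norm_le R {classic X}).
  move=> e e0; apply: filterS (osum e e0) => N + f /A1; exact.
exists x; split => //; last exact: avg.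
move=> f Lf; have := avg [set f]; rewrite !uniform_set1; apply.
  by move=> _ ->.
exact: muL.
Qed.
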